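(* Up to equivalence under the action of $Sp(4,\mathbb{C})$, a complete set of representatives for the two-dimensional subalgebras of $\mathfrak{sp}(4,\mathbb{C})$ containing a regular semisimple element is $$\mathfrak{t};\qquad \langle T_{3,1}, X_{\alpha}+X_{\beta}\rangle;\qquad \langle T_{a,1},X_{\alpha}\rangle,\ a\neq 0,\pm1;\qquad \langle T_{a,1},X_{\beta}\rangle,\ a\neq 0,\pm 1,$$ with the understanding that $\langle T_{a,1},X_{\alpha}\rangle\sim\langle T_{-a,1},X_{\alpha}\rangle$ and $\langle T_{a,1},X_{\beta}\rangle\sim\langle T_{a^{-1},1},X_{\beta}\rangle$, but that otherwise these algebras are pairwise not equivalent under $Sp(4,\mathbb{C})$. Moreover, for $a\neq 0,\pm1$, $$\langle T_{a,1},X_{\alpha}\rangle\sim\langle T_{\pm a^{-1},1},X_{\alpha+2\beta}\rangle\quad\text{and}\quad \langle T_{a,1},X_{\beta}\rangle\sim\langle T_{-a,1},X_{\alpha+\beta}\rangle\sim\langle T_{-a^{-1},1},X_{\alpha+\beta}\rangle .$$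
   Context: Let $J=\begin{pmatrix}0&0&1&0\\0&0&0&1\\-1&0&0&0\\0&-1&0&0\end{pmatrix}$. $\mathfrak{sp}(4,\mathbb{C})$ is the Lie algebra of $4\times4$ complex matrices $X$ with $JX^tJ=X$, and $Sp(4,\mathbb{C})=\{g\in GL(4,\mathbb{C}) : gJg^t=J\}$, acting on $\mathfrak{sp}(4,\mathbb{C})$ by conjugation $X\mapsto gXg^{-1}$. For $a,b\in\mathbb{C}$, $T_{a,b}=\mathrm{diag}(a,b,-a,-b)$, and $\mathfrak{t}=\{T_{a,b}: a,b\in\mathbb{C}\}$. With $E_{ij}$ the matrix units, $X_\alpha=E_{24}$, $X_\beta=E_{12}-E_{43}$, $X_{\alpha+\beta}=E_{14}+E_{23}$, $X_{\alpha+2\beta}=E_{13}$. $\langle\,\cdot\,\rangle$ denotes the complex linear span. Two subalgebras are equivalent, written $\sim$, if some $g\in Sp(4,\mathbb{C})$ conjugates one onto the other. A semisimple (i.e. diagonalizable) element of $\mathfrak{sp}(4,\mathbb{C})$ is regular if it has four distinct eigenvalues; $T_{a,b}$ is regular iff $a,b\neq0$ and $a\neq\pm b$. *)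

(* Defs.v *)
From mathcomp Require Import all_boot all_order all_algebra.
Set Implicit Arguments.
Unset Strict Implicit.
Unset Printing Implicit Defensive.
Import GRing.Theory.
Local Open Scope ring_scope.

(* The definitions make sense over any field F; the theorem takes F to be the *)
(* complex numbers.                                                           *)

(* Indices are 1-based: E i j has its 1 in row i and column j, 1 <= i, j <= 4 *)
Definition E {F : fieldType} (i j : nat) : 'M[F]_4 :=
  delta_mx (inord i.-1) (inord j.-1).

Definition J {F : fieldType} : 'M[F]_4 := E 1 3 + E 2 4 - E 3 1 - E 4 2.

Definition sp4 {F : fieldType} : {pred 'M[F]_4} :=
  [pred X : 'M[F]_4 | J *m X^T *m J == X].

Definition Sp4 {F : fieldType} : {pred 'M[F]_4} :=
  [pred g : 'M[F]_4 | (g \in unitmx) && (g *m J *m g^T == J)].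

Definition lie_bracket (F : fieldType) (X Y : 'M[F]_4) : 'M[F]_4 :=
  X *m Y - Y *m X.

Definition is_subalgebra (F : fieldType) (L : {vspace 'M[F]_4}) : Prop :=
  {subset L <= sp4} /\ {in L &, forall X Y, lie_bracket X Y \in L}.

(* g L g^-1, the image of L under the linear map X |-> (g X) g^-1 *)
Definition conj_space (F : fieldType) (g : 'M[F]_4) (L : {vspace 'M[F]_4}) :
  {vspace 'M[F]_4} := (linfun (mulmxr (invmx g) \o mulmx g) @: L)%VS.

Definition Sp4_equiv (F : fieldType) (L1 L2 : {vspace 'M[F]_4}) : Prop :=
  exists2 g : 'M[F]_4, g \in Sp4 & conj_space g L1 = L2.

Definition semisimple (F : fieldType) (X : 'M[F]_4) : Prop := diagonalizable X.

Definition regular_semisimple (F : fieldType) (X : 'M[F]_4) : Prop :=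
  [/\ X \in sp4, semisimple X &
      exists s : seq F, [/\ uniq s, size s = 4 & s =i eigenvalue X]].

Definition T (F : fieldType) (a b : F) : 'M[F]_4 :=
  diag_mx (\row_(i < 4) [:: a; b; - a; - b]`_i).

Definition X_alpha {F : fieldType} : 'M[F]_4 := E 2 4.
Definition X_beta {F : fieldType} : 'M[F]_4 := E 1 2 - E 4 3.
Definition X_alpha_beta {F : fieldType} : 'M[F]_4 := E 1 4 + E 2 3.
Definition X_alpha_2beta {F : fieldType} : 'M[F]_4 := E 1 3.

Definition plane (F : fieldType) (X Y : 'M[F]_4) : {vspace 'M[F]_4} :=
  <<[:: X; Y]>>%VS.

Definition cartan {F : fieldType} : {vspace 'M[F]_4} := plane (T 1 0) (T 0 1).

Lemma cartanP (F : fieldType) (X : 'M[F]_4) :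
  X \in cartan <-> exists a b, X = T a b.
Proof.
have TE (a b : F) : T a b = a *: T 1 0 + b *: T 0 1.
  apply/matrixP=> i j; rewrite !mxE !mulrnAr -mulrnDl; congr (_ *+ _).
  by case: i => [[|[|[|[|?]]]] ?] //=;
     rewrite ?oppr0 ?mulr0 ?mulrN ?mulr1 ?addr0 ?add0r.
rewrite /cartan /plane span_cons span_seq1; split.
  case/memv_addP=> _ /vlineP[a ->] [_ /vlineP[b ->] ->].
  by exists a, b; rewrite -TE.
by case=> a [b ->]; rewrite TE memv_add ?memvZ ?memv_line.
Qed.

(* Labels for the listed subalgebras; the parameter of the two families must  *)
(* satisfy [admissible].                                                      *)
Inductive label (F : fieldType) : Type :=
| Lcartan
| Lalpha_plus_beta
| Lalpha of F
| Lbeta of F.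
Arguments Lcartan {F}.
Arguments Lalpha_plus_beta {F}.

Definition admissible (F : fieldType) (l : label F) : Prop :=
  match l with
  | Lalpha a | Lbeta a => [/\ a <> 0, a <> 1 & a <> -1]
  | _ => True
  end.

Definition representative (F : fieldType) (l : label F) : {vspace 'M[F]_4} :=
  match l with
  | Lcartan => cartan
  | Lalpha_plus_beta => plane (T 3%:R 1) (X_alpha + X_beta)
  | Lalpha a => plane (T a 1) X_alpha
  | Lbeta a => plane (T a 1) X_beta
  end.

(* The coincidences between listed subalgebras: the parameters a and -a give  *)
(* equivalent subalgebras in the alpha family, a and a^-1 in the beta family. *)
Definition identified (F : fieldType) (l1 l2 : label F) : Prop :=
  match l1, l2 with
  | Lcartan, Lcartan => True
  | Lalpha_plus_beta, Lalpha_plus_beta => True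
  | Lalpha a, Lalpha a' => a' = a \/ a' = - a
  | Lbeta a, Lbeta a' => a' = a \/ a' = a^-1
  | _, _ => False
  end.

(* Main.v *)
(* A regular semisimple X has four distinct eigenvalues, and the symplectic    *)
(* form pairs its eigenvectors for opposite ones; a rescaled eigenbasis is     *)
(* therefore symplectic and conjugates X to some T a b. A two-dimensional      *)
(* subalgebra containing T a b is spanned by T a b and a second element, which *)
(* is either diagonal, giving the Cartan subalgebra, or may be taken to be an  *)
(* eigenvector of ad (T a b) with eigenvalue d <> 0, that is, a combination of *)
(* the root vectors whose roots take the value d at T a b. For regular T a b   *)
(* two roots agree only if they are, up to the Weyl group, alpha and beta with *)
(* a = 3 b. The Weyl group and the torus then bring the subalgebra to the      *)
(* listed form. Inequivalence: conjugation carries [L, L] = <X> to <X'> and T  *)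
(* to c T' modulo X', so that the eigenvalues of ad T and ad T' differ by the  *)
(* factor c and tr T^2 = c^2 tr T'^2, which determines the parameter; whether  *)
(* X has rank one and whether X^2 = 0 separates the three kinds.               *)

Require Import Defs.
From mathcomp Require Import all_boot all_order all_algebra.
From mathcomp Require Import reals.
From mathcomp.real_closed Require Import complex.
From mathcomp Require Import ring.
Import GRing.Theory Num.Theory.
Local Open Scope ring_scope.

(** In an eigenbasis of a regular semisimple [X], the condition $JX^tJ=X$ lets [J] pair eigenvectors
    for $d_i$ and $d_j$ nontrivially only if $d_i+d_j=0$. Since the form is nondegenerate and skew,
    the basis splits into two hyperbolic pairs, and rescaling conjugates [X] to some [T a b]
    ([regular_diag]).

    The roots $\alpha,\beta,\alpha+\beta,\alpha+2\beta$ take the values $2b$, $a-b$, $a+b$, $2a$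
    there, none of them zero. If $[T,Y]=cT+dY$ with $d\neq0$, the Cartan part of [Y] is a multiple
    of [T], so [Y] may be replaced by an eigenvector of $\mathrm{ad}\,T$; if $d=0$, [Y] is diagonal
    ([classified_plane]). Distinct roots of equal length never agree at a regular element, so an
    eigenvector involves at most one long and one short root; both occur only if $a=\pm3b$ or
    $b=\pm3a$, and Weyl reflections reduce this to $\alpha$ and $\beta$ with $a=3b$
    ([classified_rootmx]).

    For inequivalence, the derived algebra of a nonabelian representative is the line of its
    nilpotent generator [R]. An equivalence therefore matches these lines and sends [T] to
    $cT'+rR'$; comparing root values and $\mathrm{tr}\,T^2$ ([conj_invariants]) and eliminating $c$
    pins down the parameter. Rank one isolates [X_alpha], and square zero separates [X_beta] from
    [X_alpha + X_beta] ([equiv_identified]). The coincidences are Weyl reflections. *)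

Definition mx4 {F : fieldType} (s : seq (seq F)) : 'M[F]_4 :=
  \matrix_(i, j) nth 0 (nth [::] s i) j.

(* [x, y, q, p] are the coordinates on the positive roots alpha, beta,        *)
(* alpha + beta, alpha + 2 beta, the primed ones those on their opposites.    *)
Definition rootmx {F : fieldType} (x y q p x' y' q' p' : F) : 'M[F]_4 :=
  mx4 [:: [:: 0; y; p; q]; [:: y'; 0; q; x];
          [:: p'; q'; 0; - y']; [:: q'; x'; - y; 0]].

(** * Entrywise calculus of explicit 4 by 4 matrices *)

Section ExplicitMatrices.
Context {F : fieldType}.
Variables (a11 a12 a13 a14 a21 a22 a23 a24 a31 a32 a33 a34 a41 a42 a43 a44 : F).
Variables (b11 b12 b13 b14 b21 b22 b23 b24 b31 b32 b33 b34 b41 b42 b43 b44 : F).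

Let A := mx4 [:: [:: a11; a12; a13; a14]; [:: a21; a22; a23; a24];
                 [:: a31; a32; a33; a34]; [:: a41; a42; a43; a44]].
Let B := mx4 [:: [:: b11; b12; b13; b14]; [:: b21; b22; b23; b24];
                 [:: b31; b32; b33; b34]; [:: b41; b42; b43; b44]].

(** Makes an unknown matrix explicit, so that the entrywise rules apply to it too. *)
Lemma mx4_eta (M : 'M[F]_4) (o := fun k (lt_k4 : (k < 4)%N) => Ordinal lt_k4)
    (e := fun i j lt_i4 lt_j4 => M (o i lt_i4) (o j lt_j4)) :
  M = mx4 [:: [:: e 0%N 0%N isT isT; e 0%N 1%N isT isT;
                  e 0%N 2%N isT isT; e 0%N 3%N isT isT];
              [:: e 1%N 0%N isT isT; e 1%N 1%N isT isT;
                  e 1%N 2%N isT isT; e 1%N 3%N isT isT];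
              [:: e 2%N 0%N isT isT; e 2%N 1%N isT isT;
                  e 2%N 2%N isT isT; e 2%N 3%N isT isT];
              [:: e 3%N 0%N isT isT; e 3%N 1%N isT isT;
                  e 3%N 2%N isT isT; e 3%N 3%N isT isT]].
Proof.
apply/matrixP => i j; rewrite mxE.
by case: i j => -[|[|[|[|//]]]] ? -[[|[|[|[|//]]]] ?];
   congr (M _ _); apply/val_inj.
Qed.

Lemma mx4D : A + B =
  mx4 [:: [:: a11 + b11; a12 + b12; a13 + b13; a14 + b14];
          [:: a21 + b21; a22 + b22; a23 + b23; a24 + b24];
          [:: a31 + b31; a32 + b32; a33 + b33; a34 + b34];
          [:: a41 + b41; a42 + b42; a43 + b43; a44 + b44]].
Proof.
apply/matrixP => i j; rewrite !mxE.
by case: i j => -[|[|[|[|//]]]] ? -[[|[|[|[|//]]]] ?].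
Qed.

Lemma mx4N : - A =
  mx4 [:: [:: - a11; - a12; - a13; - a14]; [:: - a21; - a22; - a23; - a24];
          [:: - a31; - a32; - a33; - a34]; [:: - a41; - a42; - a43; - a44]].
Proof.
apply/matrixP => i j; rewrite !mxE.
by case: i j => -[|[|[|[|//]]]] ? -[[|[|[|[|//]]]] ?].
Qed.

Lemma mx4Z c : c *: A =
  mx4 [:: [:: c * a11; c * a12; c * a13; c * a14];
          [:: c * a21; c * a22; c * a23; c * a24];
          [:: c * a31; c * a32; c * a33; c * a34];
          [:: c * a41; c * a42; c * a43; c * a44]].
Proof.
apply/matrixP => i j; rewrite !mxE.
by case: i j => -[|[|[|[|//]]]] ? -[[|[|[|[|//]]]] ?].
Qed.

Lemma mx4_tr : A^T =
  mx4 [:: [:: a11; a21; a31; a41]; [:: a12; a22; a32; a42];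
          [:: a13; a23; a33; a43]; [:: a14; a24; a34; a44]].
Proof.
apply/matrixP => i j; rewrite !mxE.
by case: i j => -[|[|[|[|//]]]] ? -[[|[|[|[|//]]]] ?].
Qed.

Lemma mx4_trace : \tr A = a11 + a22 + a33 + a44.
Proof. by rewrite /mxtrace !big_ord_recr big_ord0 !mxE /= add0r. Qed.

Lemma mx4M : A *m B =
  mx4 [:: [:: a11 * b11 + a12 * b21 + a13 * b31 + a14 * b41;
              a11 * b12 + a12 * b22 + a13 * b32 + a14 * b42;
              a11 * b13 + a12 * b23 + a13 * b33 + a14 * b43;
              a11 * b14 + a12 * b24 + a13 * b34 + a14 * b44];
          [:: a21 * b11 + a22 * b21 + a23 * b31 + a24 * b41;
              a21 * b12 + a22 * b22 + a23 * b32 + a24 * b42;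
              a21 * b13 + a22 * b23 + a23 * b33 + a24 * b43;
              a21 * b14 + a22 * b24 + a23 * b34 + a24 * b44];
          [:: a31 * b11 + a32 * b21 + a33 * b31 + a34 * b41;
              a31 * b12 + a32 * b22 + a33 * b32 + a34 * b42;
              a31 * b13 + a32 * b23 + a33 * b33 + a34 * b43;
              a31 * b14 + a32 * b24 + a33 * b34 + a34 * b44];
          [:: a41 * b11 + a42 * b21 + a43 * b31 + a44 * b41;
              a41 * b12 + a42 * b22 + a43 * b32 + a44 * b42;
              a41 * b13 + a42 * b23 + a43 * b33 + a44 * b43;
              a41 * b14 + a42 * b24 + a43 * b34 + a44 * b44]].
Proof.
apply/matrixP => i j; rewrite mxE !big_ord_recr big_ord0 !mxE /= add0r.
by case: i j => -[|[|[|[|//]]]] ? -[[|[|[|[|//]]]] ?].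
Qed.

Lemma mx4_inj : A = B ->
  [/\ [/\ a11 = b11, a12 = b12, a13 = b13 & a14 = b14],
      [/\ a21 = b21, a22 = b22, a23 = b23 & a24 = b24],
      [/\ a31 = b31, a32 = b32, a33 = b33 & a34 = b34] &
      [/\ a41 = b41, a42 = b42, a43 = b43 & a44 = b44]].
Proof.
move/matrixP => eqAB.
have e i j (lt_i4 : (i < 4)%N) (lt_j4 : (j < 4)%N) :
    A (Ordinal lt_i4) (Ordinal lt_j4) = B (Ordinal lt_i4) (Ordinal lt_j4).
  exact: eqAB.
split; split.
- by move: (e 0%N 0%N isT isT); rewrite !mxE.
- by move: (e 0%N 1%N isT isT); rewrite !mxE.
- by move: (e 0%N 2%N isT isT); rewrite !mxE.
- by move: (e 0%N 3%N isT isT); rewrite !mxE.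
- by move: (e 1%N 0%N isT isT); rewrite !mxE.
- by move: (e 1%N 1%N isT isT); rewrite !mxE.
- by move: (e 1%N 2%N isT isT); rewrite !mxE.
- by move: (e 1%N 3%N isT isT); rewrite !mxE.
- by move: (e 2%N 0%N isT isT); rewrite !mxE.
- by move: (e 2%N 1%N isT isT); rewrite !mxE.
- by move: (e 2%N 2%N isT isT); rewrite !mxE.
- by move: (e 2%N 3%N isT isT); rewrite !mxE.
- by move: (e 3%N 0%N isT isT); rewrite !mxE.
- by move: (e 3%N 1%N isT isT); rewrite !mxE.
- by move: (e 3%N 2%N isT isT); rewrite !mxE.
- by move: (e 3%N 3%N isT isT); rewrite !mxE.
Qed.

End ExplicitMatrices.

Definition mx4E := (@mx4M, @mx4D, @mx4N, @mx4Z, @mx4_tr).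

Ltac ring4 := rewrite ?mx4E; congr mx4; repeat congr cons; ring.

(** * Cartan and root coordinates on the symplectic Lie algebra *)

Section Coordinates.
Context {F : fieldType}.
Implicit Types (a b c d x y q p : F) (X Y Z g : 'M[F]_4) (L : {vspace 'M[F]_4}).

Lemma E_mxE (i j : nat) (k l : 'I_4) : (i < 4)%N -> (j < 4)%N ->
  E i.+1 j.+1 k l = ((k == i :> nat) && (l == j :> nat))%:R :> F.
Proof. by move=> i4 j4; rewrite mxE -!val_eqE /= !inordK. Qed.

Lemma J_mx4 : J = mx4 [:: [:: 0; 0; 1; 0]; [:: 0; 0; 0; 1];
                          [:: -1; 0; 0; 0]; [:: 0; -1; 0; 0]] :> 'M[F]_4.
Proof.
rewrite /J; apply/matrixP => i j; rewrite !(E_mxE, mxE) //.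
by case: i j => -[|[|[|[|//]]]] ? -[[|[|[|[|//]]]] ?] /=; ring.
Qed.

Lemma T_mx4 a b : T a b = mx4 [:: [:: a; 0; 0; 0]; [:: 0; b; 0; 0];
                                  [:: 0; 0; - a; 0]; [:: 0; 0; 0; - b]].
Proof.
rewrite /T; apply/matrixP => i j; rewrite !mxE -val_eqE.
by case: i j => -[|[|[|[|//]]]] ? -[[|[|[|[|//]]]] ?].
Qed.

Lemma X_alphaE : X_alpha = rootmx 1 0 0 0 0 0 0 0 :> 'M[F]_4.
Proof.
rewrite /X_alpha; apply/matrixP => i j; rewrite !(E_mxE, mxE) //.
by case: i j => -[|[|[|[|//]]]] ? -[[|[|[|[|//]]]] ?] /=; ring.
Qed.

Lemma X_betaE : X_beta = rootmx 0 1 0 0 0 0 0 0 :> 'M[F]_4.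
Proof.
rewrite /X_beta; apply/matrixP => i j; rewrite !(E_mxE, mxE) //.
by case: i j => -[|[|[|[|//]]]] ? -[[|[|[|[|//]]]] ?] /=; ring.
Qed.

Lemma X_alpha_betaE : X_alpha_beta = rootmx 0 0 1 0 0 0 0 0 :> 'M[F]_4.
Proof.
rewrite /X_alpha_beta; apply/matrixP => i j; rewrite !(E_mxE, mxE) //.
by case: i j => -[|[|[|[|//]]]] ? -[[|[|[|[|//]]]] ?] /=; ring.
Qed.

Lemma X_alpha_2betaE : X_alpha_2beta = rootmx 0 0 0 1 0 0 0 0 :> 'M[F]_4.
Proof.
rewrite /X_alpha_2beta; apply/matrixP => i j; rewrite !(E_mxE, mxE) //.
by case: i j => -[|[|[|[|//]]]] ? -[[|[|[|[|//]]]] ?] /=; ring.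
Qed.

Lemma X_alpha_plus_betaE :
  X_alpha + X_beta = rootmx 1 1 0 0 0 0 0 0 :> 'M[F]_4.
Proof. by rewrite X_alphaE X_betaE /rootmx; ring4. Qed.

Lemma scale_T c a b : c *: T a b = T (c * a) (c * b).
Proof. by rewrite !T_mx4; ring4. Qed.

Lemma scale_rootmx c x y q p x' y' q' p' :
  c *: rootmx x y q p x' y' q' p' =
  rootmx (c * x) (c * y) (c * q) (c * p) (c * x') (c * y') (c * q') (c * p').
Proof. by rewrite /rootmx; ring4. Qed.

Lemma T_sp4 a b : T a b \in sp4.
Proof. by rewrite inE T_mx4 J_mx4; apply/eqP; ring4. Qed.

Lemma rootmx_sp4 x y q p x' y' q' p' : rootmx x y q p x' y' q' p' \in sp4.
Proof. by rewrite inE J_mx4 /rootmx; apply/eqP; ring4. Qed.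

(** The spanning half of the root space decomposition: six of the entry equations of $JX^tJ=X$
    determine six entries from the ten others. *)
Lemma sp4P X : X \in sp4 ->
  exists a b x y q p x' y' q' p', X = T a b + rootmx x y q p x' y' q' p'.
Proof.
rewrite inE J_mx4 (mx4_eta X) !mx4E => /eqP/mx4_inj.
set a11 := X _ _; set a12 := X _ _; set a13 := X _ _; set a14 := X _ _.
set a21 := X _ _; set a22 := X _ _; set a23 := X _ _; set a24 := X _ _.
set a31 := X _ _; set a32 := X _ _; set a33 := X _ _; set a34 := X _ _.
set a41 := X _ _; set a42 := X _ _; set a43 := X _ _; set a44 := X _ _.
move=> [[_ _ _ e14] [_ _ _ _] [e31 e32 e33 e34] [e41 e42 e43 e44]].
exists a11, a22, a24, a12, a14, a13, a42, a21, a41, a31.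
rewrite T_mx4 /rootmx mx4E; congr mx4; repeat congr cons; try ring.
- by rewrite -e14; ring.
- by rewrite -e32; ring.
- by rewrite -e33; ring.
- by rewrite -e34; ring.
- by rewrite -e43; ring.
- by rewrite -e44; ring.
Qed.

End Coordinates.

(** * Planes and the conjugation action of the symplectic group *)

Section Conjugation.
Context {F : fieldType}.
Implicit Types (a b c d x y q p : F) (X Y Z g h : 'M[F]_4).
Implicit Types L : {vspace 'M[F]_4}.

Lemma mem_plane X Y Z :
  reflect (exists c d, Z = c *: X + d *: Y) (Z \in plane X Y).
Proof.
rewrite /plane span_cons span_seq1; apply: (iffP memv_addP).
  by case=> _ /vlineP[c ->] [_ /vlineP[d ->] ->]; exists c, d.
by case=> c [d ->]; exists (c *: X); rewrite ?memvZ ?memv_line //;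
   exists (d *: Y); rewrite ?memvZ ?memv_line.
Qed.

Lemma mem_plane1 X Y : X \in plane X Y.
Proof. by apply/mem_plane; exists 1, 0; rewrite scale1r scale0r addr0. Qed.

Lemma mem_plane2 X Y : Y \in plane X Y.
Proof. by apply/mem_plane; exists 0, 1; rewrite scale1r scale0r add0r. Qed.

Lemma plane_sub X Y L : X \in L -> Y \in L -> (plane X Y <= L)%VS.
Proof.
move=> LX LY; apply/subvP => _ /mem_plane[c [d ->]].
by rewrite memvD ?memvZ.
Qed.

Lemma plane_scale c d X Y : c != 0 -> d != 0 ->
  plane (c *: X) (d *: Y) = plane X Y.
Proof.
move=> c0 d0; apply/eqP; rewrite eqEsubv !plane_sub //.
- by rewrite -{1}[X](scalerK c0) memvZ ?mem_plane1.
- by rewrite -{1}[Y](scalerK d0) memvZ ?mem_plane2.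
- by rewrite memvZ ?mem_plane1.
- by rewrite memvZ ?mem_plane2.
Qed.

Lemma dim_plane X Y : Y \notin <[X]>%VS -> X != 0 -> \dim (plane X Y) = 2%N.
Proof.
move=> XY X0; have -> : plane X Y = plane Y X.
  by apply/eqP; rewrite eqEsubv !plane_sub ?mem_plane1 ?mem_plane2.
have: free [:: Y; X] by rewrite free_cons span_seq1 XY seq1_free.
by rewrite /free => /eqP.
Qed.

Lemma plane_eq X Y L : \dim L = 2%N -> X \in L -> Y \in L -> X != 0 ->
  Y \notin <[X]>%VS -> L = plane X Y.
Proof.
move=> dL LX LY X0 XY; apply/esym/eqP.
by rewrite eqEdim plane_sub //= dim_plane ?dL.
Qed.

Lemma conj_space_plane g X Y : conj_space g (plane X Y) =
  plane (g *m X *m invmx g) (g *m Y *m invmx g).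
Proof. by rewrite /conj_space /plane limg_span /= !lfunE. Qed.

Lemma Sp4_unit g : g \in Sp4 -> g \in unitmx.
Proof. by rewrite inE => /andP[]. Qed.

Lemma Sp4_form g : g \in Sp4 -> g *m J *m g^T = J.
Proof. by rewrite inE => /andP[_ /eqP]. Qed.

Lemma J_sqr : J *m J = -1 :> 'M[F]_4.
Proof.
have -> : 1 = mx4 [:: [:: 1; 0; 0; 0]; [:: 0; 1; 0; 0]; [:: 0; 0; 1; 0];
                      [:: 0; 0; 0; 1]] :> 'M[F]_4.
  apply/matrixP => i j; rewrite !mxE -val_eqE.
  by case: i j => -[|[|[|[|//]]]] ? -[[|[|[|[|//]]]] ?].
by rewrite J_mx4; ring4.
Qed.

Lemma J_unit : J \in @unitmx F 4.
Proof.
have /mulmx1_unit[//] : J *m - J = 1%:M :> 'M[F]_4.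
by rewrite mulmxN J_sqr opprK.
Qed.

(** Invertibility is automatic: [J] is a unit, hence so is each factor of a product equal to it. *)
Lemma Sp4_intro g : g *m J *m g^T = J -> g \in Sp4.
Proof.
move=> gJ; rewrite inE gJ eqxx andbT.
by have := J_unit; rewrite -gJ !unitmx_mul => /andP[/andP[]].
Qed.

Lemma Sp4_1 : 1%:M \in @Sp4 F.
Proof. by apply: Sp4_intro; rewrite trmx1 mul1mx mulmx1. Qed.

Lemma Sp4_mul g h : g \in Sp4 -> h \in Sp4 -> g *m h \in Sp4.
Proof.
move=> /Sp4_form gJ /Sp4_form hJ; apply: Sp4_intro.
by rewrite trmx_mul -[RHS]gJ -[in RHS]hJ !mulmxA.
Qed.

Lemma Sp4_inv g : g \in Sp4 -> invmx g \in Sp4.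
Proof.
move=> sg; have ug := Sp4_unit _ sg; apply: Sp4_intro.
by rewrite -[in LHS](Sp4_form _ sg) !mulmxA mulVmx // mul1mx -mulmxA -trmx_mul
  mulVmx // trmx1 mulmx1.
Qed.

Lemma J_tr : J^T = - J :> 'M[F]_4.
Proof. by rewrite J_mx4; ring4. Qed.

(** The map $X\mapsto XJ$ identifies the Lie algebra with symmetric matrices, on which [Sp4] acts by
    congruence. *)
Lemma sp4_symE X : (X \in sp4) = ((X *m J)^T == X *m J).
Proof.
rewrite inE trmx_mul J_tr -[LHS](inj_eq (can_inj (mulmxK J_unit))).
by rewrite -[_ *m J *m J]mulmxA J_sqr mulmxN mulmx1 mulNmx.
Qed.

Lemma conj_sp4 g X : g \in Sp4 -> X \in sp4 -> g *m X *m invmx g \in sp4.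
Proof.
move=> sg; have ug := Sp4_unit _ sg.
rewrite !sp4_symE => /eqP sX; apply/eqP.
have -> : g *m X *m invmx g *m J = g *m (X *m J) *m g^T.
  by rewrite -[in LHS](Sp4_form _ sg) !mulmxA mulmxKV.
by rewrite !trmx_mul -trmx_mul sX trmxK !mulmxA.
Qed.

Lemma conj_space_comp g h L : g \in unitmx -> h \in unitmx ->
  conj_space g (conj_space h L) = conj_space (g *m h) L.
Proof.
move=> ug uh; have inv_gh : invmx (g *m h) = invmx h *m invmx g by exact: invrM.
rewrite /conj_space -limg_comp; congr (_ @: _)%VS.
by apply/lfunP => X; rewrite comp_lfunE !lfunE /= inv_gh !mulmxA.
Qed.

Lemma conj_space1 L : conj_space 1%:M L = L.
Proof.
rewrite /conj_space -[RHS]lim1g; congr (_ @: _)%VS.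
by apply/lfunP => X; rewrite !lfunE /= invmx1 mul1mx mulmx1.
Qed.

Lemma Sp4_equiv_refl L : Sp4_equiv L L.
Proof. by exists 1%:M; rewrite ?Sp4_1 ?conj_space1. Qed.

Lemma Sp4_equiv_sym L1 L2 : Sp4_equiv L1 L2 -> Sp4_equiv L2 L1.
Proof.
case=> g sg <-; exists (invmx g); first exact: Sp4_inv.
have ug := Sp4_unit _ sg.
by rewrite conj_space_comp ?unitmx_inv // mulVmx ?conj_space1.
Qed.

Lemma Sp4_equiv_trans L1 L2 L3 :
  Sp4_equiv L1 L2 -> Sp4_equiv L2 L3 -> Sp4_equiv L1 L3.
Proof.
case=> g sg <- [h sh <-]; exists (h *m g); first exact: Sp4_mul.
by rewrite conj_space_comp ?Sp4_unit.
Qed.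

Lemma conj_intertwine g X X' : g \in unitmx -> g *m X = X' *m g ->
  g *m X *m invmx g = X'.
Proof. by move=> ug ->; rewrite mulmxK. Qed.

(** The intertwining form avoids inverses, so concrete [g] are checked by matrix products alone. *)
Lemma Sp4_equiv_plane g X Y X' Y' : g \in Sp4 ->
  g *m X = X' *m g -> g *m Y = Y' *m g -> Sp4_equiv (plane X Y) (plane X' Y').
Proof.
move=> sg gX gY; exists g => //; have ug := Sp4_unit _ sg.
by rewrite conj_space_plane (conj_intertwine _ _ _ ug gX)
  (conj_intertwine _ _ _ ug gY).
Qed.

Lemma conj_lie_bracket g X Y : g \in unitmx ->
  lie_bracket (g *m X *m invmx g) (g *m Y *m invmx g) =
  g *m lie_bracket X Y *m invmx g.
Proof.
by move=> ug; rewrite /lie_bracket !mulmxA !mulmxKV // mulmxBr mulmxBl !mulmxA.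
Qed.

End Conjugation.

(** * Symplectic diagonalization of a regular semisimple element *)

Section Diagonalization.
Context {F : fieldType}.
Hypothesis two_neq0 : 2%:R != 0 :> F.
Implicit Types (a b : F) (X P g : 'M[F]_4).

Definition regular_pair a b := [&& a != 0, b != 0, a != b & a != - b].

Lemma neq_opp a : a != 0 -> a != - a.
Proof.
by move=> a0; rewrite -subr_eq0 opprK -mulr2n -mulr_natl mulf_neq0.
Qed.

(** The rows of [P] are left eigenvectors. Four distinct eigenvalues all occur among the four
    diagonal entries, so these are distinct. *)
Lemma regular_eigenbasis X : regular_semisimple X ->
  exists2 P, P \in unitmx &
    exists2 d : 'rV[F]_4, P *m X = diag_mx d *m P & injective (d 0).
Proof.
case=> _ [P uP diagD] [s [Us size_s sE]]; exists P => //.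
have /diag_mxP[d dE] : is_diag_mx (P *m X *m invmx P) by rewrite -conjumx.
have PX : P *m X = diag_mx d *m P by rewrite -dE mulmxKV.
exists d => //; apply/injectiveP; apply: (leq_size_uniq Us); last first.
  by rewrite size_codom card_ord size_s.
move=> a; rewrite sE => /eigenvalueP[v vX v0].
(* A nonzero coordinate of the eigenvector in the basis [P] singles out a diagonal entry equal to
   [a]. *)
have [i wi0] : exists i, (v *m invmx P) 0 i != 0.
  apply/rV0Pn; apply: contraNneq v0 => w0.
  by rewrite -[v](mulmxKV uP) w0 mul0mx.
suff -> : a = d 0 i by apply: codom_f.
apply: (mulIf wi0).
have: v *m invmx P *m diag_mx d = a *: (v *m invmx P).
  by rewrite -dE !mulmxA mulmxKV // vX scalemxAl.
by move/rowP/(_ i); rewrite mul_mx_diag !mxE mulrC => <-.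
Qed.

Lemma unitmx_row_neq0 n (A : 'M[F]_n) i : A \in unitmx -> exists j, A i j != 0.
Proof.
move=> uA; have /rV0Pn[j] : row i A != 0.
  apply/eqP => Ai0; have: row i A *m invmx A = 0 by rewrite Ai0 mul0mx.
  rewrite -row_mul mulmxV // => /rowP/(_ i); rewrite !mxE eqxx => /eqP.
  by rewrite oner_eq0.
by rewrite mxE; exists j.
Qed.

(* The Gram matrix G of J in an eigenbasis of X satisfies (d_i + d_j) G_ij = 0 *)
(* and is invertible, so it pairs each eigenvector with exactly one other.    *)
Lemma regular_diag X : regular_semisimple X ->
  exists2 g, g \in Sp4 &
    exists a b, regular_pair a b /\ g *m X *m invmx g = T a b.
Proof.
move=> rX; have [P uP [d PX inj_d]] := regular_eigenbasis _ rX.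
have [sX _ _] := rX; move: sX; rewrite sp4_symE => /eqP sX.
pose G := P *m J *m P^T.
have uG : G \in unitmx by rewrite !unitmx_mul unitmx_tr uP J_unit.
have Gtr : G^T = - G.
  by rewrite /G !trmx_mul trmxK J_tr !(mulmxN, mulNmx) mulmxA.
(* With $D$ the diagonal matrix, $DG = P(XJ)P^t = P(XJ)^tP^t = -GD$, as $XJ$ is symmetric. *)
have DG : diag_mx d *m G = - (G *m diag_mx d).
  rewrite /G !mulmxA -PX -[P *m X *m J]mulmxA -sX trmx_mul J_tr.
  rewrite -!mulmxA -trmx_mul PX trmx_mul tr_diag_mx !mulNmx !mulmxN.
  by rewrite !mulmxA.
have Gdd i j : (d 0 i + d 0 j) * G i j = 0.
  move/matrixP: DG => /(_ i j); rewrite mul_diag_mx mul_mx_diag [LHS]mxE.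
  by rewrite [RHS]mxE [in RHS]mxE mulrDl => ->; rewrite [_ * d _ _]mulrC addNr.
have Gskew i j : G j i = - G i j by move/matrixP: Gtr => /(_ i j); rewrite !mxE.
have Gdiag i : G i i = 0.
  by apply/eqP; apply: contraT => /neq_opp; rewrite -Gskew eqxx.
have Gdual i j : G i j != 0 -> i != j /\ d 0 j = - d 0 i.
  move=> Gij; split; first by apply: contraNneq Gij => ->; rewrite Gdiag.
  have /eqP := Gdd i j; rewrite mulf_eq0 (negPf Gij) orbF addrC.
  by rewrite addr_eq0 => /eqP.
have G0 i j : d 0 i + d 0 j != 0 -> G i j = 0.
  by move=> dd; apply/eqP; have /eqP := Gdd i j; rewrite mulf_eq0 (negPf dd).
pose i : 'I_4 := ord0.
have [j Gij] := unitmx_row_neq0 _ _ i uG; have [ij dj] := Gdual _ _ Gij.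
(* The indices [i] and [j] form one dual pair; [k] outside it starts the second, with partner [l].
   The order [i], [k], [j], [l] lists the eigenvalues as $a,b,-a,-b$. *)
have [k] : exists k, k \notin [:: i; j].
  apply/existsP; rewrite -negb_forall; apply/negP => /forallP all_ij.
  have: (#|'I_4| <= size [:: i; j])%N.
    rewrite cardE.
    exact: uniq_leq_size (enum_uniq _) (fun m _ => all_ij m).
  by rewrite card_ord.
rewrite !inE negb_or => /andP[ki kj].
have [l Gkl] := unitmx_row_neq0 _ _ k uG; have [kl dl] := Gdual _ _ Gkl.
pose a := d 0 i; pose b := d 0 k.
have a0 : a != 0.
  apply: contraNneq ij => a0; apply/eqP/inj_d; rewrite dj -/a a0.
  by rewrite oppr0.
have b0 : b != 0.
  apply: contraNneq kl => b0; apply/eqP/inj_d; rewrite dl -/b b0.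
  by rewrite oppr0.
have ab : a != b by apply: contraNneq ki => /inj_d ->.
have aNb : a != - b.
  by apply: contraNneq kj => aNb; apply/eqP/inj_d; rewrite dj -/a aNb opprK.
pose p (m : 'I_4) : 'I_4 := nth i [:: i; k; j; l] m.
(* Dividing the last two vectors by their pairings with the first two turns the Gram matrix into
   [J]; [S] reorders and rescales the rows of [P]. *)
pose c (m : 'I_4) : F := nth 0 [:: 1; 1; (G i j)^-1; (G k l)^-1] m.
pose S : 'M[F]_4 := \matrix_(m, n) (c m *+ (n == p m)).
have SE (A : 'M[F]_4) m n : (S *m A) m n = c m * A (p m) n.
  rewrite mxE (bigD1 (p m)) //= mxE eqxx big1 ?addr0 // => q /negPf qp.
  by rewrite mxE qp mul0r.
have sg : S *m P \in Sp4.
  apply: Sp4_intro.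
  have -> : S *m P *m J *m (S *m P)^T = S *m (S *m G^T)^T.
    by rewrite /G !trmx_mul !trmxK !mulmxA.
  have Gik : G i k = 0 by apply: G0; rewrite addr_eq0.
  have Gil : G i l = 0 by apply: G0; rewrite dl subr_eq0.
  have Gjk : G j k = 0 by apply: G0; rewrite dj addrC subr_eq0 eq_sym.
  have Gjl : G j l = 0.
    by apply: G0; rewrite dj dl -opprD oppr_eq0 addr_eq0.
  apply/matrixP => m n; rewrite SE mxE SE J_mx4 [G^T _ _]mxE [RHS]mxE /c /p.
  have GE := (Gskew i j, Gskew i k, Gskew i l, Gskew j k, Gskew j l, Gskew k l).
  have {}GE := (GE, Gik, Gil, Gjk, Gjl, Gdiag).
  by case: m n => -[|[|[|[|//]]]] ? -[[|[|[|[|//]]]] ?] /=;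
    rewrite ?GE ?oppr0 ?mulr0 ?mul1r ?mulr1 ?mulrN ?mulVf.
exists (S *m P); first exact: sg.
exists a, b; split; first by rewrite /regular_pair a0 b0 ab.
apply: conj_intertwine; first exact: Sp4_unit.
rewrite -mulmxA PX !mulmxA; congr (_ *m _).
apply/matrixP => m n; rewrite SE /T mul_diag_mx !mxE mulrnAr mulrnAr eq_sym.
congr (_ *+ _); rewrite mulrC; congr (_ * _).
by case: m => -[|[|[|[|//]]]] ? /=.
Qed.

End Diagonalization.

(** * Weyl reflections, the torus and changes of generators *)

Section WeylGroup.
Context {F : fieldType}.
Implicit Types (a b s t x y q p : F).

(** The reflection in $\beta$: it exchanges $\alpha$ with $\alpha+2\beta$ and fixes
    $\alpha+\beta$. *)
Definition weyl_swap : 'M[F]_4 :=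
  mx4 [:: [:: 0; 1; 0; 0]; [:: 1; 0; 0; 0]; [:: 0; 0; 0; 1]; [:: 0; 0; 1; 0]].

(** The reflection in $\alpha$: it exchanges $\beta$ with $\alpha+\beta$ and fixes $\alpha+2\beta$;
    the entry $-1$ makes it symplectic. Modulo the torus it generates the Weyl group together with
    [weyl_swap]. *)
Definition weyl_flip : 'M[F]_4 :=
  mx4 [:: [:: 1; 0; 0; 0]; [:: 0; 0; 0; 1]; [:: 0; 0; 1; 0]; [:: 0; -1; 0; 0]].

Definition torus s t : 'M[F]_4 :=
  mx4 [:: [:: s; 0; 0; 0]; [:: 0; t; 0; 0];
          [:: 0; 0; s^-1; 0]; [:: 0; 0; 0; t^-1]].

Lemma plane_swap a b x y q p x' y' q' p' :
  Sp4_equiv (plane (T a b) (rootmx x y q p x' y' q' p'))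
            (plane (T b a) (rootmx p y' q x p' y q' x')).
Proof.
apply: (@Sp4_equiv_plane _ weyl_swap).
- by apply: Sp4_intro; rewrite J_mx4 /weyl_swap; ring4.
- by rewrite !T_mx4 /weyl_swap; ring4.
- by rewrite /rootmx /weyl_swap; ring4.
Qed.

Lemma plane_flip a b x y q p x' y' q' p' :
  Sp4_equiv (plane (T a b) (rootmx x y q p x' y' q' p'))
            (plane (T a (- b)) (rootmx (- x') q (- y) p (- x) q' (- y') p')).
Proof.
apply: (@Sp4_equiv_plane _ weyl_flip).
- by apply: Sp4_intro; rewrite J_mx4 /weyl_flip; ring4.
- by rewrite !T_mx4 /weyl_flip; ring4.
- by rewrite /rootmx /weyl_flip; ring4.
Qed.

(** The two parameters scale the coordinates on $\alpha$ and $\beta$ independently, enough to make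
    both equal to 1 once a square root exists. *)
Lemma plane_torus s t a b x y : s != 0 -> t != 0 ->
  Sp4_equiv (plane (T a b) (rootmx x y 0 0 0 0 0 0))
            (plane (T a b) (rootmx (t ^+ 2 * x) (s / t * y) 0 0 0 0 0 0)).
Proof.
move=> s0 t0; apply: (@Sp4_equiv_plane _ (torus s t)).
- apply: Sp4_intro; rewrite J_mx4 /torus !mx4E.
  by congr mx4; repeat congr cons; field; rewrite ?s0 ?t0.
- by rewrite !T_mx4 /torus; ring4.
- rewrite /rootmx /torus !mx4E.
  by congr mx4; repeat congr cons; field; rewrite ?s0 ?t0.
Qed.

Lemma plane_normalize a b X : b != 0 -> plane (T a b) X = plane (T (a / b) 1) X.
Proof.
move=> b0; have -> : T a b = b *: T (a / b) 1.
  by rewrite scale_T mulr1 mulrCA mulfV // mulr1.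
by rewrite -{1}[X]scale1r plane_scale ?oner_eq0.
Qed.

Lemma plane_shear c (X Y : 'M[F]_4) : plane X (c *: X + Y) = plane X Y.
Proof.
apply/eqP; rewrite eqEsubv !plane_sub ?mem_plane1 //.
  by apply/mem_plane; exists (- c), 1; rewrite scaleNr scale1r addKr.
by rewrite memvD ?memvZ ?mem_plane1 ?mem_plane2.
Qed.

End WeylGroup.

(** * Brackets with Cartan elements, and independence of Cartan and root parts *)

Section Cartan.
Context {F : fieldType}.
Implicit Types (a b c d u v x y q p : F).

Lemma T_eq0 a b : (T a b == 0) = (a == 0) && (b == 0).
Proof.
apply/eqP/andP => [T0|[/eqP-> /eqP->]]; last first.
  by rewrite -[in LHS](mul0r 0) -scale_T scale0r.
(* Writing zero as a multiple of [T a b] keeps both sides explicit for [mx4_inj]. *)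
have : T a b = 0 *: T a b by rewrite scale0r.
rewrite T_mx4 mx4Z => /mx4_inj[[aE _ _ _] [_ bE _ _] _ _].
by rewrite aE bE !mul0r !eqxx.
Qed.

Lemma dim_cartan : \dim (@cartan F) = 2%N.
Proof.
apply: dim_plane; last by rewrite T_eq0 oner_eq0.
apply/negP => /vlineP[c]; rewrite scale_T !T_mx4.
by case/mx4_inj=> _ [_ /eqP]; rewrite mulr0 oner_eq0.
Qed.

Lemma lie_T a b u v x y q p x' y' q' p' :
  lie_bracket (T a b) (T u v + rootmx x y q p x' y' q' p') =
  rootmx ((b + b) * x) ((a - b) * y) ((a + b) * q) ((a + a) * p)
         (- (b + b) * x') ((b - a) * y') (- (a + b) * q') (- (a + a) * p').
Proof. by rewrite /lie_bracket !T_mx4 /rootmx; ring4. Qed.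

Lemma lie_T_rootmx a b x y q p x' y' q' p' :
  lie_bracket (T a b) (rootmx x y q p x' y' q' p') =
  rootmx ((b + b) * x) ((a - b) * y) ((a + b) * q) ((a + a) * p)
         (- (b + b) * x') ((b - a) * y') (- (a + b) * q') (- (a + a) * p').
Proof. by rewrite /lie_bracket !T_mx4 /rootmx; ring4. Qed.

Lemma rootmx_inj x y q p x' y' q' p' x1 y1 q1 p1 x1' y1' q1' p1' :
  rootmx x y q p x' y' q' p' = rootmx x1 y1 q1 p1 x1' y1' q1' p1' ->
  [/\ [/\ x = x1, y = y1, q = q1 & p = p1] &
      [/\ x' = x1', y' = y1', q' = q1' & p' = p1']].
Proof. by case/mx4_inj=> [[_ ? ? ?] [? _ _ ?] [? ? _ _] [_ ? _ _]]. Qed.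

Lemma T_rootmx_inj a b u v x y q p x' y' q' p' x1 y1 q1 p1 x1' y1' q1' p1' :
  T a b + rootmx x y q p x' y' q' p' =
  T u v + rootmx x1 y1 q1 p1 x1' y1' q1' p1' ->
  [/\ a = u, b = v &
      rootmx x y q p x' y' q' p' = rootmx x1 y1 q1 p1 x1' y1' q1' p1'].
Proof.
move=> eqTR; suff [au bv] : a = u /\ b = v.
  by split=> //; apply: (addrI (T a b)); rewrite eqTR au bv.
move: eqTR; rewrite !T_mx4 /rootmx !mx4E => /mx4_inj[[+ _ _ _] [_ + _ _] _ _].
by rewrite !addr0.
Qed.

Lemma T_notin_root a b x y q p x' y' q' p' :
  rootmx x y q p x' y' q' p' != 0 ->
  rootmx x y q p x' y' q' p' \notin <[T a b]>%VS.
Proof.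
have R0 : rootmx 0 0 0 0 0 0 0 0 = 0 :> 'M[F]_4.
  by rewrite -(scale0r (rootmx 0 0 0 0 0 0 0 0)) scale_rootmx !mul0r.
have T0 : T 0 0 = 0 :> 'M[F]_4 by apply/eqP; rewrite T_eq0 eqxx.
move=> nzR; apply: contraNN nzR => /vlineP[c RE]; rewrite -R0; apply/eqP.
have/T_rootmx_inj[_ _] : T 0 0 + rootmx x y q p x' y' q' p' =
    T (c * a) (c * b) + rootmx 0 0 0 0 0 0 0 0.
  by rewrite T0 R0 add0r addr0 -scale_T.
by [].
Qed.

End Cartan.

(** * Every subalgebra of the required kind is equivalent to a listed one *)

Section Classification.
Context {F : numClosedFieldType}.
Implicit Types (a b c d k u v w x y q p : F) (X Y : 'M[F]_4).
Implicit Types L : {vspace 'M[F]_4}.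

(** Encodes that [rootmx x y q p x' y' q' p'] satisfies $[T_{a,b},R]=dR$: every root with a nonzero
    coordinate takes the value [d]. As implications, these conditions follow the coordinates through
    Weyl reflections. *)
Definition weights a b d x y q p x' y' q' p' :=
  [/\ [/\ x != 0 -> d = b + b, y != 0 -> d = a - b,
          q != 0 -> d = a + b & p != 0 -> d = a + a] &
      [/\ x' != 0 -> d = - (b + b), y' != 0 -> d = b - a,
          q' != 0 -> d = - (a + b) & p' != 0 -> d = - (a + a)]].

Definition classified L :=
  exists2 l : label F, admissible l & Sp4_equiv L (representative l).

Lemma classified_equiv L1 L2 :
  Sp4_equiv L1 L2 -> classified L2 -> classified L1.
Proof.
by move=> e12 [l adm_l e2]; exists l => //; apply: Sp4_equiv_trans e12 e2.
Qed.

Lemma weights_swap a b d x y q p x' y' q' p' :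
  weights a b d x y q p x' y' q' p' -> weights b a d p y' q x p' y q' x'.
Proof. by case=> [[? ? ? ?] [? ? ? ?]]; split; split; rewrite 1?[b + a]addrC. Qed.

Lemma weights_flip a b d x y q p x' y' q' p' :
  weights a b d x y q p x' y' q' p' ->
  weights a (- b) d (- x') q (- y) p (- x) q' (- y') p'.
Proof.
case=> [[wx wy wq wp] [wx' wy' wq' wp']].
split; split; rewrite ?oppr_eq0.
- by move/wx' => ->; ring.
- by move/wq => ->; ring.
- by move/wy => ->; ring.
- by move/wp => ->; ring.
- by move/wx => ->; ring.
- by move/wq' => ->; ring.
- by move/wy' => ->; ring.
- by move/wp' => ->; ring.
Qed.

Lemma regular_pair_swap a b : regular_pair a b -> regular_pair b a.
Proof.
rewrite /regular_pair [b == a]eq_sym -[b == - a]eqr_opp opprK [- b == a]eq_sym.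
by case/and4P=> -> -> -> ->.
Qed.

Lemma regular_pair_flip a b : regular_pair a b -> regular_pair a (- b).
Proof.
by rewrite /regular_pair oppr_eq0 opprK => /and4P[-> -> -> ->].
Qed.

(** Kills a coordinate whose root value [w] differs from [d]. The difference comes factored into a
    numeral [k] and a quantity [v] that regularity makes nonzero. *)
Lemma weight_vanish d w k v x : (x != 0 -> d = w) ->
  d - w = k * v -> k != 0 -> v != 0 -> x = 0.
Proof.
move=> xw dw k0 v0; apply/eqP; apply: contraT => /xw dE; move: dw.
by rewrite dE subrr => /eqP; rewrite eq_sym mulf_eq0 (negPf k0) (negPf v0).
Qed.

Ltac vanish h k v := apply: (weight_vanish _ _ k v _ h);
  [ring | by rewrite ?oppr_eq0 ?oner_eq0 ?pnatr_eq0 | done].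

Lemma ratio_admissible a b : regular_pair a b ->
  [/\ a / b <> 0, a / b <> 1 & a / b <> -1].
Proof.
case/and4P=> a0 b0 ab aNb; split; apply/eqP.
- by rewrite mulf_neq0 ?invr_eq0.
- by rewrite -(inj_eq (mulIf b0)) mulfVK // mul1r.
- by rewrite -(inj_eq (mulIf b0)) mulfVK // mulN1r.
Qed.

(** Equal values $2b=a-b$ force $a=3b$; every other root then differs from $d=2b$ by a nonzero
    multiple of $b$. *)
Lemma classified_alpha_beta a b d x y q p x' y' q' p' : regular_pair a b ->
  weights a b d x y q p x' y' q' p' -> x != 0 -> y != 0 ->
  classified (plane (T a b) (rootmx x y q p x' y' q' p')).
Proof.
case/and4P=> _ b0 _ _ [[wx wy wq wp] [wx' wy' wq' wp']] x0 y0.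
have aE : a = 3%:R * b.
  by apply: (addIr (- b)); rewrite -wy // wx //; ring.
have dE : d = 2%:R * b by rewrite wx //; ring.
subst a d.
have -> : q = 0 by vanish wq (- 2%:R : F) b.
have -> : p = 0 by vanish wp (- 4%:R : F) b.
have -> : x' = 0 by vanish wx' (4%:R : F) b.
have -> : y' = 0 by vanish wy' (4%:R : F) b.
have -> : q' = 0 by vanish wq' (6%:R : F) b.
have -> : p' = 0 by vanish wp' (8%:R : F) b.
exists Lalpha_plus_beta => //=.
rewrite plane_normalize // mulfK // X_alpha_plus_betaE.
(* Chosen so that $t^2x=1$; then $s=t/y$ gives $(s/t)y=1$. *)
pose t := (sqrtC x)^-1.
have t0 : t != 0 by rewrite invr_eq0 sqrtC_eq0.
have tx : t ^+ 2 * x = 1 by rewrite exprVn sqrtCK mulVf.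
have sy : t / y / t * y = 1 by field; rewrite t0 y0.
have := plane_torus (t / y) t 3%:R 1 x y; rewrite tx sy.
by apply=> //; exact: mulf_neq0 t0 (invr_neq0 y0).
Qed.

(** Besides $\alpha$, only $\beta$ and $-(\alpha+\beta)$ can take the value $2b$ at a regular
    element. Either one reduces to the previous lemma; otherwise $\alpha$ stands alone. *)
Lemma classified_alpha a b d x y q p x' y' q' p' : regular_pair a b ->
  weights a b d x y q p x' y' q' p' -> x != 0 ->
  classified (plane (T a b) (rootmx x y q p x' y' q' p')).
Proof.
move=> rab wab x0; have [y0|y0] := eqVneq y 0; last first.
  by apply: (classified_alpha_beta _ _ d).
have [q'0|q'0] := eqVneq q' 0; last first.
  (* Reflecting the first coordinate moves -(alpha + beta) to beta. *)
  apply: classified_equiv _ _ (plane_swap _ _ _ _ _ _ _ _ _ _) _.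
  apply: classified_equiv _ _ (plane_flip _ _ _ _ _ _ _ _ _ _) _.
  apply: classified_equiv _ _ (plane_swap _ _ _ _ _ _ _ _ _ _) _.
  apply: (classified_alpha_beta _ _ d) => //.
    exact/regular_pair_swap/regular_pair_flip/regular_pair_swap.
  exact/weights_swap/weights_flip/weights_swap.
have/and4P[a0 b0 ab aNb] := rab.
have {}ab : a - b != 0 by rewrite subr_eq0.
have {}aNb : a + b != 0 by rewrite addr_eq0.
case: wab => [[wx _ wq wp] [wx' wy' _ wp']].
have dE : d = 2%:R * b by rewrite wx //; ring.
subst d y q'.
have -> : q = 0 by vanish wq (- 1 : F) (a - b).
have -> : p = 0 by vanish wp (- 2%:R : F) (a - b).
have -> : x' = 0 by vanish wx' (4%:R : F) b.
have -> : y' = 0 by vanish wy' (1 : F) (a + b).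
have -> : p' = 0 by vanish wp' (2%:R : F) (a + b).
exists (Lalpha (a / b)); first exact: ratio_admissible.
rewrite /= plane_normalize // X_alphaE.
have -> : rootmx x 0 0 0 0 0 0 0 = x *: rootmx 1 0 0 0 0 0 0 0.
  by rewrite scale_rootmx mulr1 mulr0.
rewrite -{1}[T _ _]scale1r plane_scale ?oner_eq0 //.
exact: Sp4_equiv_refl.
Qed.

(** With the long roots absent $\beta$ stands alone: the other short roots differ from $a-b$ by
    $-2b$, $2(a-b)$ or $2a$. *)
Lemma classified_beta a b d y q y' q' : regular_pair a b ->
  weights a b d 0 y q 0 0 y' q' 0 -> y != 0 ->
  classified (plane (T a b) (rootmx 0 y q 0 0 y' q' 0)).
Proof.
move=> rab [[_ wy wq _] [_ wy' wq' _]] y0.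
have/and4P[a0 b0 ab _] := rab.
have {}ab : a - b != 0 by rewrite subr_eq0.
have dE := wy y0; subst d.
have -> : q = 0 by vanish wq (- 2%:R : F) b.
have -> : y' = 0 by vanish wy' (2%:R : F) (a - b).
have -> : q' = 0 by vanish wq' (2%:R : F) a.
exists (Lbeta (a / b)); first exact: ratio_admissible.
rewrite /= plane_normalize // X_betaE.
have -> : rootmx 0 y 0 0 0 0 0 0 = y *: rootmx 0 1 0 0 0 0 0 0.
  by rewrite scale_rootmx mulr1 mulr0.
rewrite -{1}[T _ _]scale1r plane_scale ?oner_eq0 //.
exact: Sp4_equiv_refl.
Qed.

(** Long roots are treated before short ones, so that a mixed eigenvector is caught by
    [classified_alpha] and the remaining ones involve short roots only. Reflections move any long
    root to $\alpha$ and any short root to $\beta$. *)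
Lemma classified_rootmx a b d x y q p x' y' q' p' : regular_pair a b ->
  weights a b d x y q p x' y' q' p' -> rootmx x y q p x' y' q' p' != 0 ->
  classified (plane (T a b) (rootmx x y q p x' y' q' p')).
Proof.
move=> rab wab R0.
have alpha_case a1 b1 x1 y1 q1 p1 x1' y1' q1' p1' : regular_pair a1 b1 ->
    weights a1 b1 d x1 y1 q1 p1 x1' y1' q1' p1' -> (x1 != 0) || (x1' != 0) ->
    classified (plane (T a1 b1) (rootmx x1 y1 q1 p1 x1' y1' q1' p1')).
  move=> r1 w1 /orP[x0|x0']; first by apply: (classified_alpha _ _ d).
  apply: classified_equiv _ _ (plane_flip _ _ _ _ _ _ _ _ _ _) _.
  apply: (classified_alpha _ _ d); first exact: regular_pair_flip.
    exact: weights_flip.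
  by rewrite oppr_eq0.
have beta_case a1 b1 y1 q1 y1' q1' : regular_pair a1 b1 ->
    weights a1 b1 d 0 y1 q1 0 0 y1' q1' 0 -> (y1 != 0) || (y1' != 0) ->
    classified (plane (T a1 b1) (rootmx 0 y1 q1 0 0 y1' q1' 0)).
  move=> r1 w1 /orP[y0|y0']; first by apply: (classified_beta _ _ d).
  apply: classified_equiv _ _ (plane_swap _ _ _ _ _ _ _ _ _ _) _.
  apply: (classified_beta _ _ d) => //; first exact: regular_pair_swap.
  exact: weights_swap.
have [/alpha_case|] := boolP ((x != 0) || (x' != 0)); first exact.
rewrite negb_or !negbK => /andP[/eqP x0 /eqP x0']; subst x x'.
have [pp'|] := boolP ((p != 0) || (p' != 0)).
  apply: classified_equiv _ _ (plane_swap _ _ _ _ _ _ _ _ _ _) _.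
  by apply: alpha_case => //; [apply: regular_pair_swap | apply: weights_swap].
rewrite negb_or !negbK => /andP[/eqP p0 /eqP p0']; subst p p'.
have [/beta_case|] := boolP ((y != 0) || (y' != 0)); first exact.
rewrite negb_or !negbK => /andP[/eqP y0 /eqP y0']; subst y y'.
have [qq'|] := boolP ((q != 0) || (q' != 0)).
  apply: classified_equiv _ _ (plane_flip _ _ _ _ _ _ _ _ _ _) _.
  have := weights_flip _ _ _ _ _ _ _ _ _ _ _ wab; rewrite oppr0 => w1.
  by apply: beta_case => //; apply: regular_pair_flip.
rewrite negb_or !negbK => /andP[/eqP q0 /eqP q0']; subst q q'.
by move: R0; rewrite -(mulr0 0) -scale_rootmx scale0r eqxx.
Qed.

Lemma classified_plane a b Y : regular_pair a b -> Y \in sp4 ->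
  lie_bracket (T a b) Y \in plane (T a b) Y -> Y \notin <[T a b]>%VS ->
  classified (plane (T a b) Y).
Proof.
move=> rab /sp4P[u [v [x [y [q [p [x' [y' [q' [p' ->]]]]]]]]]].
have/and4P[a0 b0 ab aNb] := rab.
have {}ab : a - b != 0 by rewrite subr_eq0.
have {}aNb : a + b != 0 by rewrite addr_eq0.
have T0 : T 0 0 = 0 :> 'M[F]_4 by apply/eqP; rewrite T_eq0 eqxx.
rewrite lie_T => /mem_plane[c [d]].
rewrite scalerDr !scale_T scale_rootmx addrA => eqR.
(* The bracket has no Cartan part; writing it as [T 0 0] allows the Cartan and root parts to be
   compared separately. *)
have {eqR} : T 0 0 + rootmx ((b + b) * x) ((a - b) * y) ((a + b) * q)
    ((a + a) * p) (- (b + b) * x') ((b - a) * y') (- (a + b) * q')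
    (- (a + a) * p') = T (c * a + d * u) (c * b + d * v) +
    rootmx (d * x) (d * y) (d * q) (d * p) (d * x') (d * y') (d * q') (d * p').
  rewrite T0 add0r eqR; congr (_ + _).
  by rewrite !T_mx4; ring4.
case/T_rootmx_inj=> cu cv /rootmx_inj[[ex ey eq ep] [ex' ey' eq' ep']].
have mulI z w : z != 0 -> w * z = d * z -> d = w.
  by move=> z0 /(mulIf z0).
have wab : weights a b d x y q p x' y' q' p'.
  by split; split=> /mulI; apply.
have [d0|d0] := eqVneq d 0; last first.
  have -> : T u v = - (c / d) *: T a b.
    rewrite scale_T; congr T; apply: (mulfI d0).
      by rewrite -[LHS](addKr (c * a)) -cu; field.
    by rewrite -[LHS](addKr (c * b)) -cv; field.
  rewrite plane_shear => YT; apply: (classified_rootmx _ _ d) => //.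
  apply: contraNneq YT => ->; rewrite addr0; exact/memvZ/memv_line.
(* No root vanishes at a regular element, so for $d=0$ every root coordinate of [Y] is zero. *)
subst d.
case: wab => [[wx wy wq wp] [wx' wy' wq' wp']].
have -> : x = 0 by vanish wx (- 2%:R : F) b.
have -> : y = 0 by vanish wy (- 1 : F) (a - b).
have -> : q = 0 by vanish wq (- 1 : F) (a + b).
have -> : p = 0 by vanish wp (- 2%:R : F) a.
have -> : x' = 0 by vanish wx' (2%:R : F) b.
have -> : y' = 0 by vanish wy' (1 : F) (a - b).
have -> : q' = 0 by vanish wq' (1 : F) (a + b).
have -> : p' = 0 by vanish wp' (2%:R : F) a.
rewrite -(mulr0 0) -scale_rootmx scale0r addr0 => YT.
exists Lcartan => //=; rewrite -(plane_eq _ _ (@cartan F)) ?dim_cartan //.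
- exact: Sp4_equiv_refl.
- by apply/cartanP; exists a, b.
- by apply/cartanP; exists u, v.
- by rewrite T_eq0 negb_and a0.
Qed.

Lemma classification L : is_subalgebra L -> \dim L = 2%N ->
  (exists2 X, X \in L & regular_semisimple X) -> classified L.
Proof.
move=> [subL lieL] dimL [X LX rX].
have two0 : 2%:R != 0 :> F by rewrite pnatr_eq0.
have [g sg [a [b [rab gX]]]] := regular_diag two0 _ rX.
have ug := Sp4_unit _ sg.
have gK : injective (fun Z : 'M[F]_4 => g *m Z *m invmx g).
  move=> Z1 Z2 /= /(can_inj (mulmxKV ug)); exact: (can_inj (mulKmx ug)).
have Tab0 : T a b != 0 by rewrite T_eq0 negb_and; case/and4P: rab => ->.
have X0 : X != 0.
  by apply: contraNneq Tab0 => X0; rewrite -gX X0 mulmx0 mul0mx.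
have /subvPn[Y LY YX] : ~~ (L <= <[X]>)%VS.
  by apply/negP => /dimvS; rewrite dimL dim_vline X0.
have LE := plane_eq _ _ _ dimL LX LY X0 YX.
apply: (classified_equiv _ (conj_space g L)); first by exists g.
rewrite {1}LE conj_space_plane gX; apply: classified_plane => //.
- exact/conj_sp4/subL.
- rewrite -gX conj_lie_bracket // -conj_space_plane -LE.
  have := lieL _ _ LX LY; move/(memv_img (linfun (mulmxr (invmx g) \o mulmx g))).
  by rewrite lfunE.
- apply: contraNN YX => /vlineP[c]; rewrite -gX => gY; apply/vlineP; exists c.
  by apply: gK; rewrite gY -scalemxAr -scalemxAl.
Qed.

End Classification.

(** * The listed planes are subalgebras with a regular element *)

Section Representatives.
Context {F : fieldType}.
Implicit Types (a b c d k m x y : F) (X Y Z : 'M[F]_4).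

Lemma lie_plane X Y c d c' d' :
  lie_bracket (c *: X + d *: Y) (c' *: X + d' *: Y) =
  (c * d' - d * c') *: lie_bracket X Y.
Proof.
rewrite /lie_bracket !(mulmxDl, mulmxDr) -!(scalemxAl, scalemxAr) !scalerA.
by apply/matrixP => i j; rewrite !mxE; ring.
Qed.

Lemma plane_subalgebra X Y m : X \in sp4 -> Y \in sp4 ->
  lie_bracket X Y = m *: Y -> is_subalgebra (plane X Y).
Proof.
rewrite !sp4_symE => /eqP sX /eqP sY lieXY; split.
  move=> _ /mem_plane[c [d ->]]; rewrite sp4_symE mulmxDl -!scalemxAl.
  by rewrite linearD !linearZ /= sX sY.
move=> _ _ /mem_plane[c [d ->]] /mem_plane[c' [d' ->]].
by rewrite lie_plane lieXY !memvZ ?mem_plane2.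
Qed.

Lemma T_regular a b : 2%:R != 0 :> F -> regular_pair a b ->
  regular_semisimple (T a b).
Proof.
move=> two0 /and4P[a0 b0 ab aNb]; split; first exact: T_sp4.
  exact: diagonalizable_diag.
exists [:: a; b; - a; - b]; split=> //.
  have bNa : b != - a by rewrite -eqr_opp opprK eq_sym.
  by rewrite /= !inE !negb_or eqr_opp ab aNb bNa !neq_opp.
move=> z; apply/idP/eigenvalueP => [|[v vT v0]].
  move=> zs; have zi : (index z [:: a; b; - a; - b] < 4)%N.
    by move: zs; rewrite -index_mem.
  exists (delta_mx 0 (Ordinal zi)).
    rewrite -rowE; apply/rowP => j; rewrite /T !mxE eq_sym /= nth_index //.
    by case: eqP; rewrite ?mulr1 ?mulr0.
  by apply/rV0Pn; exists (Ordinal zi); rewrite !mxE !eqxx oner_eq0.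
have /rV0Pn[i vi] := v0.
have zE : z = [:: a; b; - a; - b]`_i.
  apply: (mulIf vi); move/rowP: vT => /(_ i).
  by rewrite /T mul_mx_diag !mxE mulrC => <-.
by rewrite zE mem_nth.
Qed.

Lemma dim_plane_rootmx a b x y q p x' y' q' p' : T a b != 0 ->
  rootmx x y q p x' y' q' p' != 0 ->
  \dim (plane (T a b) (rootmx x y q p x' y' q' p')) = 2%N.
Proof. by move=> T0 R0; apply: dim_plane => //; apply: T_notin_root. Qed.

(** The hypotheses demand that [m] be the value of each root actually present; with both present
    this means $a=3$ and $m=2$. *)
Lemma lie_T_simple a x y m : m = 2%:R \/ x = 0 -> m = a - 1 \/ y = 0 ->
  lie_bracket (T a 1) (rootmx x y 0 0 0 0 0 0) =
  m *: rootmx x y 0 0 0 0 0 0.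
Proof.
move=> mx my; rewrite lie_T_rootmx scale_rootmx !mulr0.
congr rootmx; first by case: mx => ->; rewrite ?mulr0 //; ring.
by case: my => ->; rewrite ?mulr0.
Qed.

Lemma rootmx_simple_eq0 x y :
  (rootmx x y 0 0 0 0 0 0 == 0) = (x == 0) && (y == 0).
Proof.
have R0 : rootmx 0 0 0 0 0 0 0 0 = 0 :> 'M[F]_4.
  by rewrite -(scale0r (rootmx 0 0 0 0 0 0 0 0)) scale_rootmx !mul0r.
apply/eqP/andP => [|[/eqP-> /eqP->] //]; rewrite -R0.
by case/rootmx_inj=> [[-> -> _ _] _]; rewrite !eqxx.
Qed.

End Representatives.

(** * Conjugation invariants of the listed subalgebras *)

Section Invariants.
Context {F : numClosedFieldType}.
Implicit Types (a b c d k m x y : F) (X Y Z g : 'M[F]_4).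
Implicit Types l : label F.

Lemma admissible_regular a :
  [/\ a <> 0, a <> 1 & a <> -1] -> regular_pair a 1.
Proof.
by case=> /eqP a0 /eqP a1 /eqP aN1; rewrite /regular_pair a0 a1 aN1 oner_eq0.
Qed.

Lemma regular_pair31 : regular_pair (3%:R : F) 1.
Proof.
rewrite /regular_pair pnatr_eq0 oner_eq0 -subr_eq0 -[_ == - 1]subr_eq0.
have -> : 3%:R - 1 = 2%:R :> F by ring.
have -> : 3%:R - - 1 = 4%:R :> F by ring.
by rewrite !pnatr_eq0.
Qed.

(** Common normal form of the three nonabelian kinds, with [m] the eigenvalue of $\mathrm{ad}\,T$ on
    the nilpotent generator, so that one argument compares them all. *)
Definition nonabelian_label l a x y m :=
  [/\ representative l = plane (T a 1) (rootmx x y 0 0 0 0 0 0),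
      regular_pair a 1, m != 0, rootmx x y 0 0 0 0 0 0 != 0 &
      lie_bracket (T a 1) (rootmx x y 0 0 0 0 0 0) =
        m *: rootmx x y 0 0 0 0 0 0].

Lemma nonabelian_Lalpha a : admissible (Lalpha a) ->
  nonabelian_label (Lalpha a) a 1 0 2%:R.
Proof.
move=> adm; split; rewrite ?rootmx_simple_eq0 ?oner_eq0 ?pnatr_eq0 //=.
- by rewrite X_alphaE.
- exact: admissible_regular.
- by apply: lie_T_simple; [left | right].
Qed.

Lemma nonabelian_Lbeta a : admissible (Lbeta a) ->
  nonabelian_label (Lbeta a) a 0 1 (a - 1).
Proof.
move=> adm; split; rewrite ?rootmx_simple_eq0 ?oner_eq0 ?andbF //=.
- by rewrite X_betaE.
- exact: admissible_regular.
- by case: adm => _ /eqP; rewrite subr_eq0.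
- by apply: lie_T_simple; [right | left].
Qed.

Lemma nonabelian_Lalpha_plus_beta :
  nonabelian_label Lalpha_plus_beta 3%:R 1 1 2%:R.
Proof.
split; rewrite ?rootmx_simple_eq0 ?oner_eq0 ?pnatr_eq0 //=.
- by rewrite X_alpha_plus_betaE.
- exact: regular_pair31.
- by apply: lie_T_simple; left=> //; ring.
Qed.

Lemma nonabelian_labelP l : admissible l ->
  l = Lcartan \/ exists a x y m, nonabelian_label l a x y m.
Proof.
case: l => [||a|a] adm; [by left | right ..].
- by do 4!eexists; apply: nonabelian_Lalpha_plus_beta.
- by do 4!eexists; apply: nonabelian_Lalpha.
- by do 4!eexists; apply: nonabelian_Lbeta.
Qed.

Lemma representative_spec l : admissible l ->
  [/\ is_subalgebra (representative l), \dim (representative l) = 2%N &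
      exists2 X, X \in representative l & regular_semisimple X].
Proof.
have two0 : 2%:R != 0 :> F by rewrite pnatr_eq0.
case/nonabelian_labelP => [->|[a [x [y [m [-> ra _ R0 lieTR]]]]]].
  split; last 1 first.
  - exists (T 3%:R 1); first by apply/cartanP; exists 3%:R, 1.
    exact/T_regular/regular_pair31.
  - apply: (plane_subalgebra _ _ 0); rewrite ?T_sp4 //.
    by rewrite scale0r /lie_bracket /T diag_mxC subrr.
  - exact: dim_cartan.
have T0 : T a 1 != 0 by rewrite T_eq0 oner_eq0 andbF.
split; last by exists (T a 1); [apply: mem_plane1 | apply: T_regular].
  by apply: plane_subalgebra lieTR; [apply: T_sp4 | apply: rootmx_sp4].
exact: dim_plane_rootmx.
Qed.

(** Diagonal matrices commute, hence so do their conjugates, whereas the bracket here is a nonzero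
    multiple of a nonzero matrix. *)
Lemma cartan_not_nonabelian l a x y m : nonabelian_label l a x y m ->
  ~ Sp4_equiv cartan (representative l).
Proof.
case=> -> _ m0 R0 lieTR [g sg eqL]; have ug := Sp4_unit _ sg.
have cartan_im Z : Z \in plane (T a 1) (rootmx x y 0 0 0 0 0 0) ->
    exists u v, Z = g *m T u v *m invmx g.
  rewrite -eqL => /memv_imgP[Z' /cartanP[u [v ->]] ->].
  by exists u, v; rewrite lfunE.
have [u [v TE]] := cartan_im _ (mem_plane1 _ _).
have [u' [v' RE]] := cartan_im _ (mem_plane2 _ _).
have := lieTR; rewrite {1}TE {1}RE conj_lie_bracket //.
rewrite /lie_bracket {1 2 3 4}/T diag_mxC subrr mulmx0 mul0mx => /eqP.
by rewrite eq_sym scaler_eq0 (negPf m0) (negPf R0).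
Qed.

(** Write the images of the generators as $cT'+rR'$ and $uT'+kR'$. Comparing $[T,R]=mR$ in both
    bases gives $u=0$ and $m=cm'$; the trace of the square of the first image gives the last
    equation. *)
Lemma conj_invariants l a x y m l' a' x' y' m' :
  nonabelian_label l a x y m -> nonabelian_label l' a' x' y' m' ->
  Sp4_equiv (representative l) (representative l') ->
  exists g c k, [/\ g \in unitmx, k != 0,
    g *m rootmx x y 0 0 0 0 0 0 *m invmx g = k *: rootmx x' y' 0 0 0 0 0 0,
    m = c * m' & a ^+ 2 + 1 = c ^+ 2 * (a' ^+ 2 + 1)].
Proof.
case=> -> _ m0 R0 lieTR [-> _ m'0 R'0 lieTR'] [g sg eqL].
have ug := Sp4_unit _ sg; move: eqL; rewrite conj_space_plane.
set T1 := T a 1 in lieTR *; set R1 := rootmx x y 0 0 0 0 0 0 in R0 lieTR *.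
set T2 := T a' 1 in lieTR' *.
set R2 := rootmx x' y' 0 0 0 0 0 0 in R'0 lieTR' *.
move=> eqL.
have := mem_plane1 (g *m T1 *m invmx g) (g *m R1 *m invmx g).
have := mem_plane2 (g *m T1 *m invmx g) (g *m R1 *m invmx g).
rewrite eqL => /mem_plane[u [k RE]] /mem_plane[c [r TE]].
have : lie_bracket (g *m T1 *m invmx g) (g *m R1 *m invmx g) =
    m *: (g *m R1 *m invmx g).
  by rewrite conj_lie_bracket // lieTR -scalemxAr -scalemxAl.
rewrite TE RE lie_plane lieTR' scalerDr !scalerA => /eqP.
rewrite -subr_eq0 opprD addrCA -scalerBl -scaleNr => /eqP.
set w := _ - _ => eq0.
have indep s t : s *: T2 + t *: R2 = 0 -> s = 0 /\ t = 0.
  move=> st0; suff t0 : t = 0.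
    split=> //; move/eqP: st0; rewrite t0 scale0r addr0 scaler_eq0.
    by rewrite T_eq0 oner_eq0 andbF orbF => /eqP.
  apply/eqP; apply: contraT => t0.
  have /negP[] := T_notin_root a' 1 _ _ _ _ _ _ _ _ R'0.
  apply/vlineP; exists (- (t^-1 * s)); apply: (scalerI t0).
  rewrite scalerA mulrN mulVKf // scaleNr.
  by apply/eqP; rewrite -addr_eq0 addrC st0.
have [mu0 w0] := indep _ _ eq0.
have u0 : u = 0.
  by apply/eqP; move/eqP: mu0; rewrite oppr_eq0 mulf_eq0 (negPf m0).
have k0 : k != 0.
  apply: contraNneq R0 => k0; have : g *m R1 *m invmx g = 0.
    by rewrite RE u0 k0 !scale0r addr0.
  move=> /(congr1 (fun Z => invmx g *m (Z *m g))).
  by rewrite mulmxKV // mulKmx // mul0mx mulmx0 => ->.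
exists g, c, k; split=> //.
- by rewrite RE u0 scale0r add0r.
- apply: (mulIf k0); move/eqP: w0; rewrite /w u0 mulr0 subr0 subr_eq0.
  by move/eqP => <-; ring.
(* The terms in [r] contribute no trace, leaving $2(a^2+1)=2c^2(a'^2+1)$. *)
have : \tr (T1 *m T1) = \tr ((c *: T2 + r *: R2) *m (c *: T2 + r *: R2)).
  have -> : (c *: T2 + r *: R2) *m (c *: T2 + r *: R2) =
      g *m (T1 *m T1) *m invmx g by rewrite -TE !mulmxA mulmxKV.
  by rewrite [RHS]mxtrace_mulC mulKmx.
rewrite /T1 /T2 /R2 !T_mx4 /rootmx !mx4E !mx4_trace => trE.
have two0 : 2%:R != 0 :> F by rewrite pnatr_eq0.
apply: (mulfI two0).
by apply: (etrans _ (etrans trE _)); ring.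
Qed.

End Invariants.

(** * Deciding equivalence among the listed subalgebras *)

Section Comparison.
Context {F : numClosedFieldType}.
Implicit Types (a b c k x y : F) (X Y Z g : 'M[F]_4) (l : label F).

(* For X <> 0 the identity X Z X = tr (X Z) X for all Z says that X has rank 1. *)
Lemma conj_sandwich g k X Y : g \in unitmx -> k != 0 ->
  g *m X *m invmx g = k *: Y ->
  (forall Z, X *m Z *m X = \tr (X *m Z) *: X) ->
  forall Z, Y *m Z *m Y = \tr (Y *m Z) *: Y.
Proof.
move=> ug k0 gX sandwich Z; apply: (scalerI k0); apply: (scalerI k0).
have -> : k *: (k *: (Y *m Z *m Y)) = (k *: Y) *m Z *m (k *: Y).
  by rewrite -scalemxAr -!scalemxAl.
have -> : k *: (k *: (\tr (Y *m Z) *: Y)) =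
    \tr ((k *: Y) *m Z) *: (k *: Y).
  by rewrite -scalemxAl mxtraceZ !scalerA; congr (_ *: _); ring.
rewrite -gX.
have -> : g *m X *m invmx g *m Z *m (g *m X *m invmx g) =
    g *m (X *m (invmx g *m Z *m g) *m X) *m invmx g by rewrite !mulmxA.
rewrite sandwich -scalemxAr -scalemxAl; congr (_ *: _).
by rewrite !mulmxA mxtrace_mulC !mulmxA.
Qed.

Lemma X_alpha_sandwich Z : let X := rootmx 1 0 0 0 0 0 0 0 : 'M[F]_4 in
  X *m Z *m X = \tr (X *m Z) *: X.
Proof. by rewrite /= (mx4_eta Z) /rootmx !mx4M mx4_trace; ring4. Qed.

Lemma not_sandwich x :
  ~ (forall Z, let X := rootmx x 1 0 0 0 0 0 0 : 'M[F]_4 in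
     X *m Z *m X = \tr (X *m Z) *: X).
Proof.
(* For the root vector [Z] of $-\beta$, $\mathrm{tr}(XZ)=2$, while the entry of $XZX$ in row 1 and
   column 2 is 1. *)
pose Z : 'M[F]_4 := rootmx 0 0 0 0 0 1 0 0.
move=> /(_ Z) /=; rewrite /rootmx !mx4M mx4_trace mx4Z.
case/mx4_inj=> [[_ + _ _] _ _ _] => /eqP.
rewrite -subr_eq0; set z := (X in X == 0).
have -> : z = -1 by rewrite /z; ring.
by rewrite oppr_eq0 oner_eq0.
Qed.

(** [X_beta] squares to zero; the square of $X_\alpha+X_\beta$ is nonzero in row 1, column 4. *)
Lemma X_beta_not_X_alpha_plus_beta g k : g \in unitmx -> k != 0 ->
  g *m rootmx 0 1 0 0 0 0 0 0 *m invmx g <> k *: rootmx 1 1 0 0 0 0 0 0 :> 'M[F]_4.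
Proof.
set X := rootmx _ _ _ _ _ _ _ _; set Y := rootmx _ _ _ _ _ _ _ _.
move=> ug k0 gX; have XX : X *m X = 0.
  rewrite -(scale0r X) /X /rootmx; ring4.
have : (k *: Y) *m (k *: Y) = 0.
  by rewrite -gX !mulmxA mulmxKV // -[g *m X *m X]mulmxA XX mulmx0 mul0mx.
rewrite -(scale0r Y) /Y /rootmx !mx4E => /mx4_inj[[_ _ _ kk0] _ _ _].
have /eqP : k ^+ 2 = 0 by apply: (etrans _ (etrans kk0 _)); ring.
by rewrite sqrf_eq0 (negPf k0).
Qed.

Lemma equiv_identified l1 l2 : admissible l1 -> admissible l2 ->
  Sp4_equiv (representative l1) (representative l2) -> identified l1 l2.
Proof.
move=> adm1 adm2 e12; have e21 := Sp4_equiv_sym _ _ e12.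
have sandwich_alpha := X_alpha_sandwich.
case: l1 adm1 e12 e21 => [||a|a] adm1; case: l2 adm2 => [||a'|a'] adm2 //= e12 e21.
- exact: (cartan_not_nonabelian _ _ _ _ _ nonabelian_Lalpha_plus_beta e12).
- exact: (cartan_not_nonabelian _ _ _ _ _ (nonabelian_Lalpha _ adm2) e12).
- exact: (cartan_not_nonabelian _ _ _ _ _ (nonabelian_Lbeta _ adm2) e12).
- exact: (cartan_not_nonabelian _ _ _ _ _ nonabelian_Lalpha_plus_beta e21).
- have [g [c [k [ug k0 gX _ _]]]] := conj_invariants _ _ _ _ _ _ _ _ _ _
    (nonabelian_Lalpha _ adm2) nonabelian_Lalpha_plus_beta e21.
  exact: (not_sandwich 1 (conj_sandwich _ _ _ _ ug k0 gX sandwich_alpha)).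
- have [g [c [k [ug k0 gX _ _]]]] := conj_invariants _ _ _ _ _ _ _ _ _ _
    (nonabelian_Lbeta _ adm2) nonabelian_Lalpha_plus_beta e21.
  exact: X_beta_not_X_alpha_plus_beta ug k0 gX.
- exact: (cartan_not_nonabelian _ _ _ _ _ (nonabelian_Lalpha _ adm1) e21).
- have [g [c [k [ug k0 gX _ _]]]] := conj_invariants _ _ _ _ _ _ _ _ _ _
    (nonabelian_Lalpha _ adm1) nonabelian_Lalpha_plus_beta e12.
  exact: (not_sandwich 1 (conj_sandwich _ _ _ _ ug k0 gX sandwich_alpha)).
- have [g [c [k [_ _ _ cE aE]]]] := conj_invariants _ _ _ _ _ _ _ _ _ _
    (nonabelian_Lalpha _ adm1) (nonabelian_Lalpha _ adm2) e12.
  have two0 : 2%:R != 0 :> F by rewrite pnatr_eq0.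
  (* In the alpha family the root value is always 2, so $c=1$ and the trace identity leaves
     $a^2=a'^2$. *)
  have c1 : c = 1 by apply: (mulIf two0); rewrite -cE mul1r.
  apply/pred2P; rewrite -eqf_sqr eq_sym; apply/eqP/(addIr 1).
  by rewrite aE c1 expr1n mul1r.
- have [g [c [k [ug k0 gX _ _]]]] := conj_invariants _ _ _ _ _ _ _ _ _ _
    (nonabelian_Lalpha _ adm1) (nonabelian_Lbeta _ adm2) e12.
  exact: (not_sandwich 0 (conj_sandwich _ _ _ _ ug k0 gX sandwich_alpha)).
- exact: (cartan_not_nonabelian _ _ _ _ _ (nonabelian_Lbeta _ adm1) e21).
- have [g [c [k [ug k0 gX _ _]]]] := conj_invariants _ _ _ _ _ _ _ _ _ _
    (nonabelian_Lbeta _ adm1) nonabelian_Lalpha_plus_beta e12.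
  exact: X_beta_not_X_alpha_plus_beta ug k0 gX.
- have [g [c [k [ug k0 gX _ _]]]] := conj_invariants _ _ _ _ _ _ _ _ _ _
    (nonabelian_Lalpha _ adm2) (nonabelian_Lbeta _ adm1) e21.
  exact: (not_sandwich 0 (conj_sandwich _ _ _ _ ug k0 gX sandwich_alpha)).
have [g [c [k [_ _ _ cE aE]]]] := conj_invariants _ _ _ _ _ _ _ _ _ _
  (nonabelian_Lbeta _ adm1) (nonabelian_Lbeta _ adm2) e12.
(* Eliminating c leaves 2 (a a' - 1) (a' - a) = 0. *)
have /eqP : 2%:R * ((a' - a) * (a' * a - 1)) = 0.
  have : (a ^+ 2 + 1) * (a' - 1) ^+ 2 = (a' ^+ 2 + 1) * (a - 1) ^+ 2.
    by rewrite aE cE; ring.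
  move/eqP; rewrite -subr_eq0 => /eqP <-; ring.
rewrite !mulf_eq0 pnatr_eq0 !subr_eq0 /= => /orP[/eqP->|/eqP a'a]; [by left | right].
have a0 : a != 0 by case: adm1 => /eqP.
by apply: (mulIf a0); rewrite a'a mulVf.
Qed.

(** The reflection in $\alpha+2\beta$, built as swap, flip, swap, fixes $\alpha$ and negates the
    first parameter. *)
Lemma alpha_equiv_opp a :
  Sp4_equiv (plane (T a 1) X_alpha) (plane (T (- a) 1) X_alpha).
Proof.
rewrite X_alphaE.
apply: Sp4_equiv_trans (plane_swap _ _ _ _ _ _ _ _ _ _) _.
apply: Sp4_equiv_trans (plane_flip _ _ _ _ _ _ _ _ _ _) _.
apply: Sp4_equiv_trans (plane_swap _ _ _ _ _ _ _ _ _ _) _.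
rewrite !oppr0; exact: Sp4_equiv_refl.
Qed.

Lemma alpha_equiv_alpha_2beta a : a != 0 ->
  Sp4_equiv (plane (T a 1) X_alpha) (plane (T a^-1 1) X_alpha_2beta).
Proof.
move=> a0; rewrite X_alphaE X_alpha_2betaE -[a^-1]mul1r -plane_normalize //.
exact: plane_swap.
Qed.

(** Reflection in $\alpha$ gives $T_{a,-1}$ and $-X_{\alpha+\beta}$; negating both generators
    restores the second parameter 1. *)
Lemma beta_equiv_alpha_beta a :
  Sp4_equiv (plane (T a 1) X_beta) (plane (T (- a) 1) X_alpha_beta).
Proof.
rewrite X_betaE X_alpha_betaE.
apply: Sp4_equiv_trans (plane_flip _ _ _ _ _ _ _ _ _ _) _.
rewrite -(plane_scale (-1) (-1)) ?oppr_eq0 ?oner_eq0 //.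
rewrite scale_T scale_rootmx !(mulN1r, oppr0, opprK).
exact: Sp4_equiv_refl.
Qed.

Lemma alpha_beta_equiv_inv a : a != 0 ->
  Sp4_equiv (plane (T a 1) X_alpha_beta) (plane (T a^-1 1) X_alpha_beta).
Proof.
move=> a0; rewrite X_alpha_betaE -[a^-1]mul1r -plane_normalize //.
exact: plane_swap.
Qed.

(** Passes to $\alpha+\beta$, which the swap fixes while inverting the normalized parameter, and
    back; the two sign changes cancel. *)
Lemma beta_equiv_inv a : a != 0 ->
  Sp4_equiv (plane (T a 1) X_beta) (plane (T a^-1 1) X_beta).
Proof.
move=> a0; apply: Sp4_equiv_trans (beta_equiv_alpha_beta a) _.
apply: Sp4_equiv_trans (alpha_beta_equiv_inv _ _) _; rewrite ?oppr_eq0 //.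
by rewrite invrN; apply/Sp4_equiv_sym/beta_equiv_alpha_beta.
Qed.

Lemma identified_equiv l1 l2 : admissible l1 -> admissible l2 ->
  identified l1 l2 -> Sp4_equiv (representative l1) (representative l2).
Proof.
case: l1 => [||a|a]; case: l2 => [||a'|a'] //= adm1 _.
- by move=> _; apply: Sp4_equiv_refl.
- by move=> _; apply: Sp4_equiv_refl.
- by case=> ->; [apply: Sp4_equiv_refl | apply: alpha_equiv_opp].
- case=> ->; [exact: Sp4_equiv_refl | apply: beta_equiv_inv].
  by case: adm1 => /eqP.
Qed.

End Comparison.

Theorem theorem6p2 (R : realType) :
  [/\ (* each listed space is a two-dimensional subalgebra of the required kind *)
      (forall l : label R[i], admissible l ->
         [/\ is_subalgebra (representative l), \dim (representative l) = 2%N &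
             exists2 X, X \in representative l & regular_semisimple X]),
      (* every such subalgebra is equivalent to a listed one *)
      (forall L : {vspace 'M[R[i]]_4},
         is_subalgebra L -> \dim L = 2%N ->
         (exists2 X, X \in L & regular_semisimple X) ->
         exists2 l : label R[i], admissible l & Sp4_equiv L (representative l)),
      (* the equivalences among listed subalgebras are exactly the stated ones *)
      (forall l1 l2 : label R[i], admissible l1 -> admissible l2 ->
         (Sp4_equiv (representative l1) (representative l2) <->
          identified l1 l2)) &
      forall a : R[i], a <> 0 -> a <> 1 -> a <> -1 ->
        [/\ Sp4_equiv (plane (T a 1) X_alpha)
                      (plane (T a^-1 1) X_alpha_2beta),
            Sp4_equiv (plane (T a 1) X_alpha)
                      (plane (T (- a^-1) 1) X_alpha_2beta),
            Sp4_equiv (plane (T a 1) X_beta)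
                      (plane (T (- a) 1) X_alpha_beta) &
            Sp4_equiv (plane (T (- a) 1) X_alpha_beta)
                      (plane (T (- a^-1) 1) X_alpha_beta)]].
Proof.
split.
- exact: representative_spec.
- exact: classification.
- move=> l1 l2 adm1 adm2; split; first exact: equiv_identified.
  exact: identified_equiv.
move=> a /eqP a0 _ _; have aN0 : - a != 0 by rewrite oppr_eq0.
split; rewrite -?invrN.
- exact: alpha_equiv_alpha_2beta.
- apply: Sp4_equiv_trans (alpha_equiv_opp a) _.
  exact: alpha_equiv_alpha_2beta.
- exact: beta_equiv_alpha_beta.
- exact: alpha_beta_equiv_inv.
Qed.
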